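(* Let $X$ be a path-connected and uniformly locally path-connected uniform space, and let $x_0\in X$. Then the identity function $id\colon\widetilde X_J\to\widetilde X_{BP}$ is uniformly continuous if and only if $X$ is a uniform small loop transfer space.
   Context: Entourages of uniform structures are taken to be symmetric. For an entourage $E$ of $X$, $B(x,E)=\{y\in X : (x,y)\in E\}$; a subset of $X$ (or a path, via its image) is $E$-bounded if it is contained in $B(x,E)$ for some $x\in X$. $X$ is uniformly locally path-connected if for every entourage $E$ there is an entourage $F$ such that any pair $(x,y)\in F$ can be connected by an $E$-bounded path in $X$. $\widetilde X$ is the set of homotopy classes $[\alpha]$ (rel. end-points) of paths $\alpha\colon[0,1]\to X$ with $\alpha(0)=x_0$. $\widetilde X_J$ is $\widetilde X$ with the James uniform structure, whose base consists of the sets $E^\ast$, $E$ an entourage of $X$, where $E^\ast$ is the set of pairs of classes of the form $([\alpha],[\beta])$ such that $(\alpha,\beta)$ is a path in $E\subset X\times X$ originating at $(x_0,x_0)$ (i.e. the two classes have representatives $\alpha,\beta$ with $(\alpha(t),\beta(t))\in E$ for all $t$). $\widetilde X_{BP}$ is $\widetilde X$ with the Berestovskii-Plaut uniform structure, whose base consists of the sets $bp(E)$ of pairs $([\alpha],[\beta])$ such that $\alpha^{-1}\ast\beta$ is homotopic in $X$ rel. end-points to an $E$-bounded path. $X$ is a uniform small loop transfer space if for every entourage $E$ of $X$ there is an entourage $F$ of $X$ such that given two loops $\alpha\colon(S^1,1)\to(B(y,F),y)$ and $\beta\colon(S^1,1)\to(X,x)$ that are freely homotopic in $X$, there is a loop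 $\gamma\colon(S^1,1)\to(B(x,E),x)$ that is homotopic to $\beta$ in $X$ rel. base point. *)

(* Defs.v *)
From HB Require Import structures.
From mathcomp Require Import all_boot all_order all_algebra generic_quotient.
From mathcomp Require Import all_classical reals topology normedtype homotopy.
From mathcomp Require Import lra.
Set Implicit Arguments.
Unset Strict Implicit.
Unset Printing Implicit Defensive.
Import Order.TTheory GRing.Theory Num.Theory.
Import numFieldNormedType.Exports.
Local Open Scope classical_set_scope.
Local Open Scope ring_scope.
Local Open Scope quotient_scope.

Section real_continuity.
Variables (R : realType) (T : topologicalType).
Implicit Types f g : T -> R.

Lemma continuousRD f g : continuous f -> continuous g -> continuous (fun t => f t + g t).
Proof. by move=> cf cg t; apply: (@cvgD _ R^o); [exact: cf | exact: cg]. Qed.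

Lemma continuousRM f g : continuous f -> continuous g -> continuous (fun t => f t * g t).
Proof. by move=> cf cg t; apply: cvgM; [exact: cf | exact: cg]. Qed.

Lemma continuousRB f g : continuous f -> continuous g -> continuous (fun t => f t - g t).
Proof. by move=> cf cg t; apply: (@cvgB _ R^o); [exact: cf | exact: cg]. Qed.

Lemma continuousRmin f g : continuous f -> continuous g ->
  continuous (fun t => Num.min (f t) (g t)).
Proof. by move=> cf cg t; apply: (@continuous_min R); [exact: cf | exact: cg]. Qed.

Lemma continuousRmax f g : continuous f -> continuous g ->
  continuous (fun t => Num.max (f t) (g t)).
Proof. by move=> cf cg t; apply: (@continuous_max R); [exact: cf | exact: cg]. Qed.

Lemma continuous_cmp (U V : topologicalType) (h : T -> U) (k : U -> V) :
  continuous k -> continuous h -> continuous (fun t => k (h t)).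
Proof. by move=> ck ch t; apply: continuous_comp; [exact: ch | exact: ck]. Qed.

Lemma continuous_mkpair (U V : topologicalType) (h : T -> U) (k : T -> V) :
  continuous h -> continuous k -> continuous (fun t => (h t, k t)).
Proof. by move=> ch ck t; apply: cvg_pair; [exact: ch | exact: ck]. Qed.
Lemma continuousRc (c : R) : continuous (fun _ : T => c).
Proof. by move=> t; exact: cvg_cst. Qed.

End real_continuity.
Lemma continuous_fst (T U : topologicalType) : continuous (@fst T U).
Proof. by move=> t; exact: cvg_fst. Qed.
Lemma continuous_snd (T U : topologicalType) : continuous (@snd T U).
Proof. by move=> t; exact: cvg_snd. Qed.

Definition unit_interval (R : realType) : Type :=
  set_type (`[0%R, 1%R]%classic : set R).

Section unit_interval.
Variable R : realType.
Local Notation I := (unit_interval R).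

HB.instance Definition _ := Uniform.copy I (set_type (`[0%R, 1%R]%classic : set R)).

Definition ival (t : I) : R := set_val t.

Lemma clamp_subproof (r : R) :
  Num.min 1 (Num.max 0 r) \in (`[0%R, 1%R]%classic : set R).
Proof.
rewrite inE /= in_itv /=; apply/andP; split.
  by rewrite le_min ler01 le_max lexx.
by rewrite ge_min lexx.
Qed.

Definition clamp (r : R) : I :=
  exist (fun x => x \in (`[0%R, 1%R]%classic : set R)) _ (clamp_subproof r).

Lemma ival_inj : injective ival. Proof. exact: val_inj. Qed.

Lemma ival_ge0 (t : I) : 0 <= ival t.
Proof. by case: t => r /= ; rewrite /ival set_valE /= inE /= in_itv /= => /andP[]. Qed.

Lemma ival_le1 (t : I) : ival t <= 1.
Proof. by case: t => r /= ; rewrite /ival set_valE /= inE /= in_itv /= => /andP[]. Qed.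

Lemma ival_clampE r : ival (clamp r) = Num.min 1 (Num.max 0 r).
Proof. by rewrite /ival set_valE. Qed.

Lemma ival_clamp r : 0 <= r -> r <= 1 -> ival (clamp r) = r.
Proof. by move=> r0 r1; rewrite ival_clampE max_r // min_r. Qed.

Lemma clampK : cancel ival clamp.
Proof. by move=> t; apply: ival_inj; rewrite ival_clamp ?ival_ge0 ?ival_le1. Qed.

Lemma clamp_le0 r : r <= 0 -> clamp r = clamp 0.
Proof. by move=> r0; apply: ival_inj; rewrite !ival_clampE !max_l. Qed.

Lemma clamp_ge1 r : 1 <= r -> clamp r = clamp 1.
Proof.
by move=> r1; apply: ival_inj; rewrite !ival_clampE !max_r ?(le_trans ler01)// !min_l.
Qed.

Lemma unit_interval_neq : clamp 0 != clamp 1.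
Proof.
apply/eqP => /(congr1 ival); rewrite !ival_clamp ?ler01 ?lexx //.
by move/esym/eqP; rewrite oner_eq0.
Qed.

HB.instance Definition _ :=
  @isBiPointed.Build I (clamp 0) (clamp 1) unit_interval_neq.

Lemma ival0 : ival (zero : I) = 0.
Proof. by rewrite ival_clamp ?ler01. Qed.

Lemma ival1 : ival (one : I) = 1.
Proof. by rewrite ival_clamp ?ler01. Qed.

Lemma ival_continuous : continuous ival.
Proof. exact: initial_continuous. Qed.

Lemma clamp_continuous : continuous clamp.
Proof.
apply: continuous_comp_initial => r /=.
apply: (@continuous_min _ _ (fun=> 1) (fun r : R => Num.max 0 r)).
  exact: cvg_cst.
apply: (@continuous_max _ _ (fun=> 0) id); [exact: cvg_cst | exact: cvg_id].
Qed.
End unit_interval.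
Arguments ival {R} t.
Arguments clamp {R} r.


Section homotopy.
Variables (R : realType) (X : topologicalType).
Local Notation I := (unit_interval R).

Definition path_connected := forall x y : X, inhabited {path I from x to y in X}.

(* H (t, s) : t is the path parameter, s the deformation parameter. *)
Definition homotopic_rel (f g : I -> X) := exists H : I * I -> X,
  [/\ continuous H, forall t, H (t, zero) = f t, forall t, H (t, one) = g t
    & forall s, H (zero, s) = f zero /\ H (one, s) = f one].

(* A loop (S^1, 1) -> (X, x) is a path in X from x to x; the last clause lets H
   descend to S^1 * I, with no condition on the track of the base point. *)
Definition freely_homotopic (f g : I -> X) := exists H : I * I -> X,
  [/\ continuous H, forall t, H (t, zero) = f t, forall t, H (t, one) = g t
    & forall s, H (zero, s) = H (one, s)].

Lemma continuous_paste (T : topologicalType) (h : T -> R) (c : R) (f g : T -> X) :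
  continuous h -> continuous f -> continuous g ->
  (forall t, h t = c -> f t = g t) ->
  continuous (fun t => if h t <= c then f t else g t).
Proof.
move=> ch cf cg fg; set k := fun t => _.
have cA : closed (h @^-1` [set r | r <= c]) by apply: closed_comp => // t _; exact: ch.
have cB : closed (h @^-1` [set r | c <= r]) by apply: closed_comp => // t _; exact: ch.
apply/continuous_subspace_setT.
have -> : [set: T] = h @^-1` [set r | r <= c] `|` h @^-1` [set r | c <= r].
  apply/seteqP; split=> // t _ /=; apply/orP; exact: le_total.
apply: withinU_continuous => //.
  apply: (subspace_eq_continuous (f := f)); last exact: continuous_subspaceT.
  by move=> t; rewrite inE /= /from_subspace /k => ->.
apply: (subspace_eq_continuous (f := g)); last exact: continuous_subspaceT.
move=> t; rewrite inE /= /from_subspace /k => ct; case: ifP => // tc.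
by apply/esym/fg/eqP; rewrite eq_le tc ct.
Qed.

Lemma clamp_comp_continuous (T : topologicalType) (h : T -> R) :
  continuous h -> continuous (fun t => clamp (h t)).
Proof. by move=> ch; apply: continuous_cmp => //; exact: clamp_continuous. Qed.

Section path_ops.
Variables x y z : X.
Implicit Types (a : {path I from x to y in X}) (b : {path I from y to z in X}).

Definition flip (t : I) : I := clamp (1 - ival t).

Lemma flip_continuous : continuous flip.
Proof.
apply: continuous_cmp; first exact: clamp_continuous.
exact: (continuousRB (@continuousRc _ _ _) (@ival_continuous _)).
Qed.

Lemma flip0 : flip zero = one.
Proof. by rewrite /flip ival0 subr0. Qed.

Lemma flip1 : flip one = zero.
Proof. by rewrite /flip ival1 subrr. Qed.

Lemma path_inv_continuous a : continuous (a \o flip).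
Proof. by apply: continuous_cmp; [exact: cts_fun | exact: flip_continuous]. Qed.

Lemma path_inv_zero a : (a \o flip) zero = y.
Proof. by rewrite /= flip0 path_one. Qed.

Lemma path_inv_one a : (a \o flip) one = x.
Proof. by rewrite /= flip1 path_zero. Qed.

Definition path_inv a : {path I from y to x in X} :=
  mk_path (@path_inv_continuous a) (path_inv_zero a) (path_inv_one a).

Definition path_cat_fun (f g : I -> X) (t : I) : X :=
  if ival t <= 2^-1 then f (clamp (2 * ival t)) else g (clamp (2 * ival t - 1)).

Lemma path_cat_continuous a b : continuous (path_cat_fun a b).
Proof.
apply: continuous_paste; first exact: ival_continuous.
- apply: continuous_cmp; first exact: cts_fun.
  exact: (clamp_comp_continuous (continuousRM (@continuousRc _ _ _) (@ival_continuous _))).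
- apply: continuous_cmp; first exact: cts_fun.
  apply: clamp_comp_continuous.
  exact: (continuousRB (continuousRM (@continuousRc _ _ _) (@ival_continuous _)) (@continuousRc _ _ _)).
- by move=> t ->; rewrite divff ?pnatr_eq0// subrr [LHS]path_one [RHS]path_zero.
Qed.

Lemma path_cat_zero a b : path_cat_fun a b zero = x.
Proof. by rewrite /path_cat_fun ival0 invr_ge0 ler0n mulr0 [LHS]path_zero. Qed.

Lemma path_cat_one a b : path_cat_fun a b one = z.
Proof.
rewrite /path_cat_fun ival1 ifF; last by apply/negbTE; rewrite -ltNge; lra.
by rewrite mulr1 (_ : 2 - 1 = 1 :> R) ?[LHS]path_one//; lra.
Qed.

Definition path_cat a b : {path I from x to z in X} :=
  mk_path (@path_cat_continuous a b) (path_cat_zero a b) (path_cat_one a b).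
End path_ops.

Definition path_cst (x : X) : {path I from x to x in X} := cst x.

Lemma homotopic_refl (f : I -> X) : continuous f -> homotopic_rel f f.
Proof.
move=> cf; exists (f \o fst); split=> // p.
by apply: continuous_comp; [exact: cvg_fst | exact: cf].
Qed.

Lemma homotopic_ends f g : homotopic_rel f g -> f zero = g zero /\ f one = g one.
Proof. by case=> H [_ _ H1 He]; rewrite -!H1 !(He one).1 !(He one).2. Qed.

Lemma homotopic_sym f g : homotopic_rel f g -> homotopic_rel g f.
Proof.
move=> fg; have [e0 e1] := homotopic_ends fg; case: fg => H [cH H0 H1 He].
exists (fun p => H (p.1, flip p.2)); split.
- apply: continuous_cmp; first exact: cH.
  apply: continuous_mkpair; first exact: continuous_fst.
  by apply: continuous_cmp; [exact: flip_continuous | exact: continuous_snd].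
- by move=> t /=; rewrite flip0.
- by move=> t /=; rewrite flip1.
- by move=> s /=; rewrite -e0 -e1; exact: He.
Qed.

Lemma homotopic_trans f g h :
  homotopic_rel f g -> homotopic_rel g h -> homotopic_rel f h.
Proof.
move=> fg; have [e0 e1] := homotopic_ends fg.
case: fg => H [cH H0 H1 He] [K [cK K0 K1 Ke]].
have c1 : continuous (fun p : I * I => ival p.2).
  by apply: continuous_cmp; [exact: ival_continuous | exact: continuous_snd].
have c2 := continuousRM (@continuousRc _ _ 2) c1.
have c3 := continuousRB c2 (@continuousRc _ _ 1).
exists (fun p => if ival p.2 <= 2^-1 then H (p.1, clamp (2 * ival p.2))
                 else K (p.1, clamp (2 * ival p.2 - 1))); split.
- apply: continuous_paste.
  + exact: c1.
  + apply: continuous_cmp; first exact: cH.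
    by apply: continuous_mkpair; [exact: continuous_fst | exact: clamp_comp_continuous].
  + apply: continuous_cmp; first exact: cK.
    by apply: continuous_mkpair; [exact: continuous_fst | exact: clamp_comp_continuous].
  + by move=> p ->; rewrite divff ?pnatr_eq0// subrr [LHS]H1 [RHS]K0.
- by move=> t /=; rewrite ival0 invr_ge0 ler0n mulr0.
- move=> t /=; rewrite ival1 ifF; last by apply/negbTE; rewrite -ltNge; lra.
  by rewrite mulr1 (_ : 2 - 1 = 1 :> R) ?[LHS]K1//; lra.
- move=> s /=; case: ifP => _; first exact: He.
  by rewrite e0 e1; exact: Ke.
Qed.

Lemma homotopic_reparam (f : I -> X) (p q : I -> R) :
  continuous f -> continuous p -> continuous q ->
  p zero = q zero -> p one = q one ->
  homotopic_rel (f \o clamp \o p) (f \o clamp \o q).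
Proof.
move=> cf cp cq e0 e1.
exists (fun u => f (clamp ((1 - ival u.2) * p u.1 + ival u.2 * q u.1))); split.
- have c2 : continuous (fun u : I * I => ival u.2).
    by apply: continuous_cmp; [exact: ival_continuous | exact: continuous_snd].
  have c1 (k : I -> R) : continuous k -> continuous (fun u : I * I => k u.1).
    by move=> ck; apply: continuous_cmp; [exact: ck | exact: continuous_fst].
  apply: continuous_cmp; first exact: cf.
  apply: clamp_comp_continuous.
  exact: (continuousRD (continuousRM (continuousRB (@continuousRc _ _ 1) c2) (c1 _ cp))
           (continuousRM c2 (c1 _ cq))).
- by move=> t /=; rewrite ival0 subr0 mul0r mul1r addr0.
- by move=> t /=; rewrite ival1 subrr mul0r mul1r add0r.
- by move=> s /=; rewrite -e0 -e1 -!mulrDl subrK !mul1r.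
Qed.

Lemma homotopic_cat x y z (a a' : {path I from x to y in X})
    (b b' : {path I from y to z in X}) :
  homotopic_rel a a' -> homotopic_rel b b' ->
  homotopic_rel (path_cat a b) (path_cat a' b').
Proof.
case=> H [cH H0 H1 He] [K [cK K0 K1 Ke]].
have c1 : continuous (fun p : I * I => ival p.1).
  by apply: continuous_cmp; [exact: ival_continuous | exact: continuous_fst].
have c2 := continuousRM (@continuousRc _ _ 2) c1.
have c3 := continuousRB c2 (@continuousRc _ _ 1).
exists (fun p => if ival p.1 <= 2^-1 then H (clamp (2 * ival p.1), p.2)
                 else K (clamp (2 * ival p.1 - 1), p.2)); split.
- apply: continuous_paste.
  + exact: c1.
  + apply: continuous_cmp; first exact: cH.
    by apply: continuous_mkpair; [exact: clamp_comp_continuous | exact: continuous_snd].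
  + apply: continuous_cmp; first exact: cK.
    by apply: continuous_mkpair; [exact: clamp_comp_continuous | exact: continuous_snd].
  + move=> p ->; rewrite divff ?pnatr_eq0// subrr.
    by rewrite [LHS](He _).2 [RHS](Ke _).1 path_one path_zero.
- by move=> t /=; rewrite /mk_path /path_cat_fun H0 K0.
- by move=> t /=; rewrite /mk_path /path_cat_fun H1 K1.
- move=> s /=; rewrite ival0 ival1 invr_ge0 ler0n mulr0 ifF; last first.
    by apply/negbTE; rewrite -ltNge; lra.
  rewrite mulr1 (_ : 2 - 1 = 1 :> R); last lra.
  rewrite [X in X = _](He _).1 [in X in _ /\ X](Ke _).2.
  by rewrite [in X in _ /\ X]path_one [in X in X /\ _]path_zero path_zero path_one.
Qed.

Lemma homotopic_inv x y (a a' : {path I from x to y in X}) :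
  homotopic_rel a a' -> homotopic_rel (path_inv a) (path_inv a').
Proof.
case=> H [cH H0 H1 He].
exists (fun p => H (flip p.1, p.2)); split.
- apply: continuous_cmp; first exact: cH.
  apply: continuous_mkpair; last exact: continuous_snd.
  by apply: continuous_cmp; [exact: flip_continuous | exact: continuous_fst].
- by move=> t; exact: H0.
- by move=> t; exact: H1.
- by move=> s /=; rewrite /mk_path /= flip0 flip1; case: (He s).
Qed.

Lemma ival_affine_continuous (c d : R) : continuous (fun t : I => c * ival t + d).
Proof.
exact: (continuousRD (continuousRM (@continuousRc _ _ _) (@ival_continuous _)) (@continuousRc _ _ _)).
Qed.

Lemma homotopic_eq f f' g g' :
  f =1 f' -> g =1 g' -> homotopic_rel f' g' -> homotopic_rel f g.
Proof. by move=> /funext -> /funext ->. Qed.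

Lemma path_reparam x y (a : {path I from x to y in X}) t :
  a t = (a \o clamp \o (fun t => 1 * ival t + 0)) t.
Proof. by rewrite /= mul1r addr0 clampK. Qed.

Lemma homotopic_catr1 x y (a : {path I from x to y in X}) :
  homotopic_rel (path_cat a (path_cst y)) a.
Proof.
apply: (@homotopic_eq _ (a \o clamp \o fun t => Num.min 1 (2 * ival t + 0)) _ _ _ (path_reparam a)).
  move=> t /=; rewrite /mk_path /path_cat_fun /= addr0.
  case: (leP (ival t)) => t2; first by rewrite min_r//; lra.
  by rewrite min_l ?[RHS]path_one//; lra.
apply: homotopic_reparam; [exact: cts_fun| | exact: ival_affine_continuous | |].
- apply: continuousRmin; [exact: continuousRc | exact: ival_affine_continuous].
- by rewrite ival0 min_r//; lra.
- by rewrite ival1 min_l//; lra.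
Qed.

Lemma homotopic_cat1r x y (a : {path I from x to y in X}) :
  homotopic_rel (path_cat (path_cst x) a) a.
Proof.
apply: (@homotopic_eq _ (a \o clamp \o fun t => Num.max 0 (2 * ival t + -1)) _ _ _ (path_reparam a)).
  move=> t /=; rewrite /mk_path /path_cat_fun /=.
  case: (leP (ival t)) => t2; last by rewrite max_r//; lra.
  by rewrite max_l ?[RHS]path_zero//; lra.
apply: homotopic_reparam; [exact: cts_fun| | exact: ival_affine_continuous | |].
- apply: continuousRmax; [exact: continuousRc | exact: ival_affine_continuous].
- by rewrite ival0 max_l//; lra.
- by rewrite ival1 max_r//; lra.
Qed.

Lemma path_invK x y (a : {path I from x to y in X}) : path_inv (path_inv a) =1 a.
Proof.
move=> t; rewrite /= /mk_path /= /mk_path /= /flip; congr (a _).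
have := ival_ge0 t; have := ival_le1 t => t1 t0.
by rewrite ival_clamp; [rewrite opprB addrC subrK clampK | lra | lra].
Qed.

Lemma homotopic_catV x y (a : {path I from x to y in X}) :
  homotopic_rel (path_cat a (path_inv a)) (path_cst x).
Proof.
apply: (@homotopic_eq _ (a \o clamp \o fun t => Num.min (2 * ival t + 0) (-2 * ival t + 2))
  _ (a \o clamp \o fun t => 0 * ival t + 0)).
- move=> t /=; rewrite /mk_path /path_cat_fun /= /mk_path /= /flip.
  have := ival_ge0 t; have := ival_le1 t => t1 t0.
  case: (leP (ival t)) => t2; first by rewrite min_l ?addr0//; lra.
  rewrite min_r; last by lra.
  by rewrite ival_clamp; [congr (a (clamp _)); lra | lra | lra].
- by move=> t /=; rewrite mul0r addr0 [RHS]path_zero.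
apply: homotopic_reparam; [exact: cts_fun| | exact: ival_affine_continuous | |].
- by apply: continuousRmin; exact: ival_affine_continuous.
- by rewrite ival0 min_l//; lra.
- by rewrite ival1 min_r//; lra.
Qed.

Lemma homotopic_eqr f g g' : g =1 g' -> homotopic_rel f g -> homotopic_rel f g'.
Proof. by move=> /funext ->. Qed.

Lemma homotopic_eql f f' g : f =1 f' -> homotopic_rel f g -> homotopic_rel f' g.
Proof. by move=> /funext ->. Qed.

Lemma path_cat_eq x y z (a a' : {path I from x to y in X})
    (b b' : {path I from y to z in X}) :
  a =1 a' -> b =1 b' -> path_cat a b =1 path_cat a' b'.
Proof. by move=> /path_eqP -> /path_eqP ->. Qed.

Lemma homotopic_catVl x y (a : {path I from x to y in X}) :
  homotopic_rel (path_cat (path_inv a) a) (path_cst y).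
Proof.
apply: homotopic_eql (homotopic_catV (path_inv a)).
by apply: path_cat_eq => //; exact: path_invK.
Qed.

Lemma assoc_min (r : R) :
  Num.min (2 * r + 0) (Num.min (1 * r + 4^-1) (2^-1 * r + 2^-1)) =
  if r <= 4^-1 then 2 * r else if r <= 2^-1 then r + 4^-1 else 2^-1 * r + 2^-1.
Proof.
rewrite addr0 mul1r /Order.min.
by case: (leP r 4^-1) => r4; case: (leP r 2^-1) => r2;
   case: (ltP (r + 4^-1)) => h1; case: ltP => h2; lra.
Qed.

Lemma homotopic_catA x y z w (a : {path I from x to y in X})
    (b : {path I from y to z in X}) (c : {path I from z to w in X}) :
  homotopic_rel (path_cat (path_cat a b) c) (path_cat a (path_cat b c)).
Proof.
apply: (@homotopic_eq _ (path_cat a (path_cat b c) \o clamp \o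
  fun t => Num.min (2 * ival t + 0) (Num.min (1 * ival t + 4^-1) (2^-1 * ival t + 2^-1)))
  _ _ _ (path_reparam _)); last first.
  apply: homotopic_reparam; [exact: cts_fun| | exact: ival_affine_continuous | |].
  - apply: continuousRmin; first exact: ival_affine_continuous.
    by apply: continuousRmin; exact: ival_affine_continuous.
  - by rewrite assoc_min ival0 invr_ge0 ler0n; lra.
  - rewrite assoc_min ival1 ifF; last by apply/negbTE; rewrite -ltNge; lra.
    by rewrite ifF; [lra | apply/negbTE; rewrite -ltNge; lra].
move=> t /=; rewrite /mk_path /path_cat_fun /= /mk_path /path_cat_fun /= assoc_min.
have := ival_ge0 t; have := ival_le1 t => t1 t0.
case: (leP (ival t) 2^-1) => t2.
- rewrite [ival (clamp (2 * ival t))]ival_clamp; [|lra|lra].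
  case: (leP (ival t) 4^-1) => t4.
  + rewrite ifT; last lra.
    rewrite [ival (clamp (2 * ival t))]ival_clamp; [|lra|lra].
    by rewrite ifT //; lra.
  + rewrite ifF; last by apply/negbTE; rewrite -ltNge; lra.
    rewrite [ival (clamp (_ + 4^-1))]ival_clamp; [|lra|lra].
    rewrite ifF; last by apply/negbTE; rewrite -ltNge; lra.
    rewrite ival_clamp; [|lra|lra].
    rewrite ifT; last by lra.
    by congr (b (clamp _)); lra.
- rewrite (_ : (ival t <= 4^-1) = false); last by apply/negbTE; rewrite -ltNge; lra.
  rewrite [ival (clamp (_ + 2^-1))]ival_clamp; [|lra|lra].
  rewrite ifF; last by apply/negbTE; rewrite -ltNge; lra.
  rewrite ival_clamp; [|lra|lra].
  rewrite ifF; last by apply/negbTE; rewrite -ltNge; lra.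
  by congr (c (clamp _)); lra.
Qed.

Lemma path_inv_cat x y z (a : {path I from x to y in X}) (b : {path I from y to z in X}) :
  path_inv (path_cat a b) =1 path_cat (path_inv b) (path_inv a).
Proof.
move=> t; rewrite /= /mk_path /= /mk_path /path_cat_fun /= /mk_path /= /flip.
have := ival_ge0 t; have := ival_le1 t => t1 t0.
rewrite [ival (clamp (1 - _))]ival_clamp; [|lra|lra].
case: (ltrgtP (ival t) 2^-1) => t2.
- rewrite ifF; last by apply/negbTE; rewrite -ltNge; lra.
  by rewrite ival_clamp; [congr (b (clamp _)); lra|lra|lra].
- rewrite ifT; last lra.
  by rewrite ival_clamp; [congr (a (clamp _)); lra|lra|lra].
- rewrite t2 ifT; last lra.
  rewrite ival_clamp; [|lra|lra].
  rewrite (_ : 2 * (1 - 2^-1) = 1); last lra.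
  rewrite (_ : 1 - 2 * 2^-1 = 0); last lra.
  by rewrite [LHS]path_one [RHS]path_zero.
Qed.

End homotopy.

Section uniform_paths.
Variables (R : realType) (X : uniformType).
Local Notation I := (unit_interval R).
Implicit Types E F : set (X * X).

(* Only symmetric entourages are quantified over below; they form a base. *)
Definition sym_entourage : set_system (X * X) :=
  [set E | entourage E /\ E^-1%relation = E].

Lemma sym_entourageE E x y : sym_entourage E -> E (x, y) -> E (y, x).
Proof. by case=> _ {1}<-. Qed.

Lemma sym_entourage_refl E x : sym_entourage E -> E (x, x).
Proof. by case=> entE _; exact: entourage_refl. Qed.

Lemma sym_entourage_sub E : entourage E -> exists2 F, sym_entourage F & F `<=` E.
Proof.
move=> entE; exists (E `&` E^-1%relation); last exact: subIsetl.
split; first exact: entourage_invI.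
by apply/seteqP; split=> -[x y] [].
Qed.

Lemma sym_entourageT : sym_entourage setT.
Proof. by split; [exact: filterT | apply/seteqP; split]. Qed.

Lemma sym_entourageI E F : sym_entourage E -> sym_entourage F -> sym_entourage (E `&` F).
Proof.
move=> sE sF; split; first by case: sE sF => ? _ [? _]; exact: filterI.
by apply/seteqP; split=> -[x y] [??]; split; exact: sym_entourageE.
Qed.

Lemma sym_entourage_split E : sym_entourage E -> exists2 F, sym_entourage F &
  forall x y z, F (x, y) -> F (y, z) -> E (x, z).
Proof.
move=> [/entourage_split_ex[G entG GE] _].
have [F sF FG] := sym_entourage_sub entG; exists F => // x y z Fxy Fyz.
by apply: GE; exists y; exact: FG.
Qed.

(* The ball B(x, E) is xsection E x. *)
Definition bounded_path E (f : I -> X) := exists x, range f `<=` xsection E x.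

Definition unif_locally_path_connected :=
  forall E, sym_entourage E -> exists2 F, sym_entourage F &
    forall x y, F (x, y) ->
      exists p : {path I from x to y in X}, bounded_path E p.

Definition unif_small_loop_transfer :=
  forall E, sym_entourage E -> exists2 F, sym_entourage F &
    forall (x y : X) (a : {path I from y to y in X}) (b : {path I from x to x in X}),
      range a `<=` xsection F y -> freely_homotopic a b ->
      exists2 c : {path I from x to x in X},
        range c `<=` xsection E x & homotopic_rel c b.

Definition based_path (x0 : X) := {y : X & {path I from x0 to y in X}}.

Section path_class.
Variable x0 : X.

Definition based_homotopic (a b : based_path x0) : bool :=
  `[< homotopic_rel (projT2 a) (projT2 b) >].

Lemma based_homotopic_refl : reflexive based_homotopic.
Proof. by move=> a; apply/asboolP/homotopic_refl; exact: cts_fun. Qed.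

Lemma based_homotopic_sym : symmetric based_homotopic.
Proof. by move=> a b; apply/asboolP/asboolP; exact: homotopic_sym. Qed.

Lemma based_homotopic_trans : transitive based_homotopic.
Proof. by move=> b a c /asboolP ab /asboolP bc; apply/asboolP/(homotopic_trans ab). Qed.

Definition based_homotopic_rel :=
  EquivRel _ based_homotopic_refl based_homotopic_sym based_homotopic_trans.

Definition path_space : Type := {eq_quot based_homotopic_rel}.
HB.instance Definition _ := Choice.copy path_space {eq_quot based_homotopic_rel}.
HB.instance Definition _ := Quotient.copy path_space {eq_quot based_homotopic_rel}.
HB.instance Definition _ := EqQuotient.copy path_space {eq_quot based_homotopic_rel}.

Definition path_class y (a : {path I from x0 to y in X}) : path_space :=
  \pi_path_space (existT _ y a).

Lemma path_classP (c : path_space) : exists y (a : {path I from x0 to y in X}), c = path_class a.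
Proof.
exists (projT1 (repr c)), (projT2 (repr c)).
by rewrite /path_class -[LHS]reprK; case: (repr c).
Qed.

Lemma path_class_eq y z (a : {path I from x0 to y in X}) (b : {path I from x0 to z in X}) :
  path_class a = path_class b <-> homotopic_rel a b.
Proof. by split=> [/eqmodP/asboolP|ab]; [|apply/eqmodP/asboolP]. Qed.

Lemma path_class_eq_end y z (a : {path I from x0 to y in X}) (b : {path I from x0 to z in X}) :
  path_class a = path_class b -> y = z.
Proof. by move/path_class_eq/homotopic_ends => [_]; rewrite !path_one. Qed.

Definition james_ent E : set (path_space * path_space) :=
  [set c | exists y z (a : {path I from x0 to y in X}) (b : {path I from x0 to z in X}),
     [/\ c.1 = path_class a, c.2 = path_class b & forall t, E (a t, b t)]].

Definition bp_ent E : set (path_space * path_space) :=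
  [set c | exists y z (a : {path I from x0 to y in X}) (b : {path I from x0 to z in X}),
     [/\ c.1 = path_class a, c.2 = path_class b &
         exists2 p : {path I from y to z in X},
           bounded_path E p & homotopic_rel (path_cat (path_inv a) b) p]].

Definition james_entourage := filter_from sym_entourage james_ent.
Definition bp_entourage := filter_from sym_entourage bp_ent.

Lemma path_cat_rel x y z x' y' z' (a : {path I from x to y in X}) (b : {path I from y to z in X})
    (a' : {path I from x' to y' in X}) (b' : {path I from y' to z' in X}) E :
  (forall t, E (a t, a' t)) -> (forall t, E (b t, b' t)) ->
  forall t, E (path_cat a b t, path_cat a' b' t).
Proof. by move=> Ea Eb t /=; rewrite /mk_path /path_cat_fun; case: ifP. Qed.

Lemma james_entourage_filter : Filter james_entourage.
Proof.
apply: filter_from_filter; first by exists setT; exact: sym_entourageT.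
move=> E F sE sF; exists (E `&` F); first exact: sym_entourageI.
move=> [c d] [y [z [a [b /= [-> -> ab]]]]].
by split; exists y, z, a, b; split=> // t; case: (ab t).
Qed.

Lemma bp_entourage_filter : Filter bp_entourage.
Proof.
apply: filter_from_filter; first by exists setT; exact: sym_entourageT.
move=> E F sE sF; exists (E `&` F); first exact: sym_entourageI.
move=> [c d] [y [z [a [b /= [-> -> [p [x px] abp]]]]]].
by split; exists y, z, a, b; split=> //; exists p => //; exists x => w /px;
  rewrite xsectionI => -[].
Qed.

Lemma james_entourage_diagonal A : james_entourage A -> diagonal `<=` A.
Proof.
move=> [E sE EA] [c d] cd; rewrite -(cd : c = d); apply: EA.
have [y [a ->]] := path_classP c; exists y, y, a, a; split=> // t.
exact: sym_entourage_refl.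
Qed.

Lemma bp_entourage_diagonal A : bp_entourage A -> diagonal `<=` A.
Proof.
move=> [E sE EA] [c d] cd; rewrite -(cd : c = d); apply: EA.
have [y [a ->]] := path_classP c; exists y, y, a, a; split=> //.
exists (path_cst _ y); last exact: homotopic_catVl.
by exists y => _ [t _ <-]; apply/xsectionP; exact: sym_entourage_refl.
Qed.

Lemma james_entourage_inv A : james_entourage A -> james_entourage A^-1%relation.
Proof.
move=> [E sE EA]; exists E => // -[c d] [y [z [a [b /= [-> -> ab]]]]]; apply: EA.
by exists z, y, b, a; split=> // t; exact: sym_entourageE.
Qed.

Lemma bp_entourage_inv A : bp_entourage A -> bp_entourage A^-1%relation.
Proof.
move=> [E sE EA]; exists E => // -[c d] [y [z [a [b /= [-> -> [p [x px] abp]]]]]]; apply: EA.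
exists z, y, b, a; split=> //; exists (path_inv p).
  by exists x => _ [t _ <-]; apply: px; eexists.
apply: homotopic_eql (homotopic_inv abp) => t.
by rewrite path_inv_cat; apply: path_cat_eq => //; exact: path_invK.
Qed.

Lemma bp_entourage_split A : bp_entourage A ->
  exists2 B, bp_entourage B & (B \; B)%relation `<=` A.
Proof.
move=> [E sE EA]; have [F sF FE] := sym_entourage_split sE.
exists (bp_ent F); first by exists F.
move=> [c d] [e [y [z [a [b /= [-> -> [p [u pu] abp]]]]]]].
case=> z' [w [b' [g /= [bb' -> [q [v qv] bgq]]]]]; apply: EA.
have zz' := path_class_eq_end bb'; subst z'; move/path_class_eq : bb' => bb'.
exists y, w, a, g; split=> //; exists (path_cat p q).
  have pz : F (u, z) by apply/xsectionP/pu; exists one => //; exact: path_one.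
  have qz : F (v, z) by apply/xsectionP/qv; exists zero => //; exact: path_zero.
  exists z => _ [t _ <-]; apply/xsectionP => /=; rewrite /mk_path /path_cat_fun.
  case: ifP => _.
    by apply: (FE _ u); [exact: sym_entourageE | apply/xsectionP/pu; eexists].
  by apply: (FE _ v); [exact: sym_entourageE | apply/xsectionP/qv; eexists].
apply: homotopic_trans (homotopic_cat abp bgq).
apply: homotopic_sym; apply: homotopic_trans (homotopic_catA _ _ _) _.
apply: homotopic_cat; first by apply: homotopic_refl; exact: cts_fun.
apply: homotopic_trans (homotopic_sym (homotopic_catA _ _ _)) _.
apply: homotopic_trans (homotopic_cat1r g).
apply: homotopic_cat; last by apply: homotopic_refl; exact: cts_fun.
apply: homotopic_trans (homotopic_catV b').
apply: homotopic_cat => //.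
by apply: homotopic_inv; apply: homotopic_refl; exact: cts_fun.
Qed.

Hypothesis lpcX : unif_locally_path_connected.

(* If (a, b) and (b', g) are paths in F with b ~ b', and d is a small path
   from a(1) to b(1), then a ~ a d b^-1 b' d^-1 and g ~ b cst b^-1 g cst are
   E-close. *)
Lemma james_entourage_split A : james_entourage A ->
  exists2 B, james_entourage B & (B \; B)%relation `<=` A.
Proof.
move=> [E sE EA]; have [E1 sE1 E1E] := sym_entourage_split sE.
have [E2 sE2 E2E1] := sym_entourage_split sE1.
have [F0 sF0 F0path] := lpcX sE2.
have [F1 sF1 F1F] : exists2 F, sym_entourage F & F `<=` E2 `&` F0.
  by exists (E2 `&` F0) => //; exact: sym_entourageI.
have E2sub G G' : sym_entourage G -> sym_entourage G' ->
    (forall x y z, G' (x, y) -> G' (y, z) -> G (x, z)) -> G' `<=` G.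
  by move=> sG sG' GG' [x y] xy; apply: (GG' _ y) => //; exact: sym_entourage_refl.
have subE1 := E2sub _ _ sE sE1 E1E; have subE2 := E2sub _ _ sE1 sE2 E2E1.
exists (james_ent F1); first by exists F1.
move=> [c d] [e [y [z [a [b /= [-> -> ab]]]]]].
case=> z' [w [b' [g /= [bb' -> bg]]]]; apply: EA.
have zz' := path_class_eq_end bb'; subst z'; move/path_class_eq : bb' => bb'.
have Fyz : F1 (y, z) by move: (ab one); rewrite !path_one.
have Fzw : F1 (z, w) by move: (bg one); rewrite !path_one.
have [p [u pu]] := F0path y z (F1F _ Fyz).2.
have puE t : E2 (u, p t) by apply/xsectionP/pu; exists t.
have uz : E2 (u, z) by have := puE one; rewrite path_one.
have pz t : E1 (p t, z) by apply: (E2E1 _ u) => //; exact: sym_entourageE.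
have pw t : E (p t, w).
  by apply: (E1E _ z) => //; apply: subE2; exact: (F1F _ Fzw).1.
have FE x : F1 x -> E x by move=> /F1F[] /subE2/subE1.
have hr u1 u2 (k : {path I from u1 to u2 in X}) : homotopic_rel k k.
  by apply: homotopic_refl; exact: cts_fun.
exists y, w.
exists (path_cat a (path_cat p (path_cat (path_inv b) (path_cat b' (path_inv p))))).
exists (path_cat b (path_cat (path_cst _ z) (path_cat (path_inv b) (path_cat g (path_cst _ w))))).
split.
- apply/path_class_eq/homotopic_sym.
  apply: homotopic_trans (homotopic_catr1 a); apply: homotopic_cat (hr _ _ _) _.
  apply: homotopic_trans (homotopic_catV p); apply: homotopic_cat (hr _ _ _) _.
  apply: homotopic_trans (homotopic_sym (homotopic_catA _ _ _)) _.
  apply: homotopic_trans (homotopic_cat1r _); apply: homotopic_cat (hr _ _ _).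
  apply: homotopic_trans (homotopic_catVl b); apply: homotopic_cat (hr _ _ _) _.
  exact: homotopic_sym.
- apply/path_class_eq/homotopic_sym.
  apply: (@homotopic_trans _ _ _ (path_cat b (path_cat (path_inv b) g))).
    apply: homotopic_cat (hr _ _ _) _.
    apply: homotopic_trans (homotopic_cat1r _) _.
    by apply: homotopic_cat (hr _ _ _) _; exact: homotopic_catr1.
  apply: homotopic_trans (homotopic_sym (homotopic_catA _ _ _)) _.
  apply: homotopic_trans (homotopic_cat1r _); apply: homotopic_cat (hr _ _ _).
  exact: homotopic_catV.
- apply: path_cat_rel; first by move=> t; exact: FE.
  apply: path_cat_rel; first by move=> t; exact: subE1.
  apply: path_cat_rel; first by move=> t; exact: sym_entourage_refl.
  apply: path_cat_rel; first by move=> t; exact: FE.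
  by move=> t; exact: pw.
Qed.

End path_class.

(* james_entourage_split makes use of uniform local path-connectedness, so the
   James structure takes the proof of this property as a parameter. *)
Definition path_space_J (lpcX : unif_locally_path_connected) (x0 : X) : Type :=
  path_space x0.

HB.instance Definition _ lpcX x0 := Choice.copy (path_space_J lpcX x0) (path_space x0).
HB.instance Definition _ lpcX x0 := isUniform.Build (path_space_J lpcX x0)
  (@james_entourage_filter x0) (@james_entourage_diagonal x0)
  (@james_entourage_inv x0) (@james_entourage_split x0 lpcX).

Definition path_space_BP (x0 : X) : Type := path_space x0.

HB.instance Definition _ x0 := Choice.copy (path_space_BP x0) (path_space x0).
HB.instance Definition _ x0 := isUniform.Build (path_space_BP x0)
  (@bp_entourage_filter x0) (@bp_entourage_diagonal x0)
  (@bp_entourage_inv x0) (@bp_entourage_split x0).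

End uniform_paths.

(* Main.v *)
Require Import Defs.
From mathcomp Require Import all_boot all_order all_algebra.
From mathcomp Require Import all_classical reals topology normedtype homotopy.
From mathcomp Require Import lra.
From Corelib Require Setoid Morphisms.

(** Both halves turn on one fact about free homotopies. If a loop [b] at [x] is
    freely homotopic to a loop [a] at [y], and [l] is the track of the base
    point, then [b] is homotopic rel end-points to [l^-1 a l]; conversely every
    such conjugate is the end of a free homotopy starting at [a]
    ([freely_homotopic_conj], [conj_freely_homotopic]). So small loop transfer
    says: conjugating a small loop by an arbitrarily long path yields, up to
    homotopy, a small loop ([transfer_conj]).

    Suppose that [id] is uniformly continuous, let [a] be a loop in [B(y,F)],
    [l] a path from [y] to [x] and [g] a path from [x0] to [x]. The paths
    [g l^-1 cst l] and [g l^-1 a l] are pointwise [F]-close, hence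
    [bp(E)]-close, which says precisely that [l^-1 a l] is homotopic to an
    [E]-bounded loop ([small_loop_of_james_sub_bp]).

    Suppose conversely that small loops transfer, and let [f] and [g] be
    pointwise close paths from [x0], ending at [y] and [z]. For each time [r]
    choose a small path [p_r] from [f r] to [g r], as uniform local
    path-connectedness allows, and consider the loop at [y] that runs back along
    [f] to [x0], out along [g] to [g r], across [p_r] to [f r] and along [f] to
    [y]. Passing from [r] to a nearby [s] multiplies this loop by the conjugate,
    along [f], of a small quadrilateral with sides [p_r], [g], [p_s], [f]; by
    transfer the conjugate is homotopic to a loop in [B(y,E)]. A product of
    loops in [B(y,E)] lies in [B(y,E)], however many factors there are, so no
    smallness is lost and the set of [r] whose loop is homotopic to one in
    [B(y,E)] is both open and closed. It contains [0] by transfer, hence it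
    contains [1] as the real line is connected, and then [f^-1 g] is homotopic to
    a loop in [B(y,E)] followed by [p_1] ([ladder_bound]). *)

Set Implicit Arguments.
Unset Strict Implicit.
Unset Printing Implicit Defensive.
Import Order.TTheory GRing.Theory Num.Theory.
Import numFieldNormedType.Exports.
Local Open Scope classical_set_scope.
Local Open Scope ring_scope.

Local Infix "\*" := path_cat (at level 40, left associativity).

(** * The groupoid of paths up to homotopy *)

Section path_homotopy.
Variables (R : realType) (X : topologicalType).
Local Notation I := (unit_interval R).

(** Homotopy of paths with fixed typed end-points: on this form of
    [homotopic_rel] setoid rewriting under [path_cat] and [path_inv] works. *)
Definition hpath (x y : X) (a b : {path I from x to y in X}) : Prop :=
  homotopic_rel a b.

Lemma hpath_eq x y (a b : {path I from x to y in X}) : a =1 b -> hpath a b.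
Proof.
by move=> ab; apply: homotopic_eqr ab _; apply: homotopic_refl; exact: cts_fun.
Qed.

Lemma hpath_refl x y (a : {path I from x to y in X}) : hpath a a.
Proof. exact: hpath_eq. Qed.

#[local] Hint Resolve hpath_refl : core.

#[global] Instance hpath_equiv x y : RelationClasses.Equivalence (@hpath x y).
Proof.
split; first by move=> a; exact: hpath_eq.
- by move=> a b; exact: homotopic_sym.
- by move=> a b c; exact: homotopic_trans.
Qed.

#[global] Instance path_cat_proper x y z :
  Morphisms.Proper (Morphisms.respectful (@hpath x y)
    (Morphisms.respectful (@hpath y z) (@hpath x z))) (@path_cat R X x y z).
Proof. by move=> a a' aa b b' bb; exact: homotopic_cat. Qed.

#[global] Instance path_inv_proper x y :
  Morphisms.Proper (Morphisms.respectful (@hpath x y) (@hpath y x)) (@path_inv R X x y).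
Proof. by move=> a a' aa; exact: homotopic_inv. Qed.

Lemma hcatA x y z w (a : {path I from x to y in X})
    (b : {path I from y to z in X}) (c : {path I from z to w in X}) :
  hpath (a \* b \* c) (a \* (b \* c)).
Proof. exact: homotopic_catA. Qed.

Lemma hcat1p x y (a : {path I from x to y in X}) : hpath (path_cst R x \* a) a.
Proof. exact: homotopic_cat1r. Qed.

Lemma hcatVl x y (a : {path I from x to y in X}) : hpath (path_inv a \* a) (path_cst R y).
Proof. exact: homotopic_catVl. Qed.

Lemma hcatVp x y z (a : {path I from x to y in X}) (b : {path I from y to z in X}) :
  hpath (path_inv a \* (a \* b)) b.
Proof. by rewrite -hcatA hcatVl hcat1p. Qed.

Lemma hcatp1 x y (a : {path I from x to y in X}) : hpath (a \* path_cst R y) a.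
Proof. exact: homotopic_catr1. Qed.

Lemma hcatpV x y (a : {path I from x to y in X}) : hpath (a \* path_inv a) (path_cst R x).
Proof. exact: homotopic_catV. Qed.

Lemma hcat_pV x y z (a : {path I from x to y in X}) (b : {path I from x to z in X}) :
  hpath (a \* (path_inv a \* b)) b.
Proof. by rewrite -hcatA hcatpV hcat1p. Qed.

Lemma continuous_interp (p q : I -> R) : continuous p -> continuous q ->
  continuous (fun v : I * I => (1 - ival v.2) * p v.1 + ival v.2 * q v.1).
Proof.
move=> cp cq; have c2 : continuous (fun v : I * I => ival v.2).
  by apply: continuous_cmp; [exact: ival_continuous | exact: continuous_snd].
have c1 (k : I -> R) : continuous k -> continuous (fun v : I * I => k v.1).
  by move=> ck; apply: continuous_cmp; [exact: ck | exact: continuous_fst].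
exact: (continuousRD (continuousRM (continuousRB (@continuousRc _ _ 1) c2) (c1 _ cp))
         (continuousRM c2 (c1 _ cq))).
Qed.

(** The two ways around the boundary of the unit square, from corner to
    opposite corner, are joined by straight lines inside the square. *)
Lemma hcat_square (H : I * I -> X) x y z w
    (b : {path I from x to y in X}) (r : {path I from y to w in X})
    (l : {path I from x to z in X}) (t : {path I from z to w in X}) :
  continuous H ->
  (forall u, H (u, zero) = b u) -> (forall s, H (one, s) = r s) ->
  (forall s, H (zero, s) = l s) -> (forall u, H (u, one) = t u) ->
  hpath (b \* r) (l \* t).
Proof.
move=> cH Hb Hr Hl Ht.
(* [u |-> (lo u, hi u)] runs along the bottom and then the right side. *)
pose lo (u : I) : R := Num.min 1 (2 * ival u).
pose hi (u : I) : R := Num.max 0 (2 * ival u - 1).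
have clo : continuous lo.
  apply: continuousRmin; first exact: continuousRc.
  exact: (continuousRM (@continuousRc _ _ _) (@ival_continuous _)).
have chi : continuous hi.
  apply: continuousRmax; first exact: continuousRc.
  exact: (continuousRB (continuousRM (@continuousRc _ _ _) (@ival_continuous _))
            (@continuousRc _ _ _)).
pose mix (p q : I -> R) (v : I * I) : I := clamp ((1 - ival v.2) * p v.1 + ival v.2 * q v.1).
have cmix p q : continuous p -> continuous q -> continuous (mix p q).
  by move=> cp cq; apply: clamp_comp_continuous; exact: continuous_interp.
have eb u : path_cat b r u = H (clamp (lo u), clamp (hi u)).
  rewrite /= /mk_path /path_cat_fun /lo /hi.
  have := ival_ge0 u; have := ival_le1 u => u1 u0.
  case: leP => u2; first by rewrite min_r ?max_l ?Hb//; lra.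
  by rewrite min_l ?max_r ?Hr//; lra.
have et u : path_cat l t u = H (clamp (hi u), clamp (lo u)).
  rewrite /= /mk_path /path_cat_fun /lo /hi.
  have := ival_ge0 u; have := ival_le1 u => u1 u0.
  case: leP => u2; first by rewrite min_r ?max_l ?Hl//; lra.
  by rewrite min_l ?max_r ?Ht//; lra.
exists (fun v => H (mix lo hi v, mix hi lo v)); split.
- apply: continuous_cmp; first exact: cH.
  by apply: continuous_mkpair; exact: cmix.
- by move=> u; rewrite eb /mix /= ival0 subr0 !mul1r !mul0r !addr0.
- by move=> u; rewrite et /mix /= ival1 subrr !mul1r !mul0r !add0r.
- have lo0 : lo zero = 0 by rewrite /lo ival0 mulr0 min_r.
  have hi0 : hi zero = 0 by rewrite /hi ival0 mulr0 max_l//; lra.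
  have lo1 : lo one = 1 by rewrite /lo ival1 min_l//; lra.
  have hi1 : hi one = 1 by rewrite /hi ival1 max_r; lra.
  move=> s; rewrite !eb /mix /= lo0 hi0 lo1 hi1 !mulr0 addr0 !mulr1.
  by rewrite subrK; split.
Qed.

(** Around the square [H] one reads [a l] one way and [l b] the other. *)
Lemma hpath_conj_track (H : I * I -> X) x y (a : {path I from y to y in X})
    (b : {path I from x to x in X}) (l : {path I from y to x in X}) :
  continuous H ->
  (forall t, H (t, zero) = a t) -> (forall t, H (t, one) = b t) ->
  (forall s, H (zero, s) = l s) -> (forall s, H (one, s) = l s) ->
  hpath b (path_inv l \* (a \* l)).
Proof.
move=> cH Ha Hb Hl0 Hl1.
by rewrite (hcat_square cH Ha Hl1 Hl0 Hb) hcatVp.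
Qed.

Lemma freely_homotopic_conj x y (a : {path I from y to y in X})
    (b : {path I from x to x in X}) :
  freely_homotopic a b ->
  exists l : {path I from y to x in X}, hpath b (path_inv l \* (a \* l)).
Proof.
case=> H [cH Ha Hb Hends].
have cl : continuous (fun s => H (zero, s)).
  apply: continuous_cmp; first exact: cH.
  by apply: continuous_mkpair => t; [exact: cst_continuous | exact: cvg_id].
have l0 : H (zero, zero) = y by rewrite Ha path_zero.
have l1 : H (zero, one) = x by rewrite Hb path_zero.
exists (mk_path cl l0 l1).
by apply: (hpath_conj_track cH) => // s; rewrite -Hends.
Qed.

(** For every [l], the conjugate [l^-1 a l] is reached from [a] by a free
    homotopy whose base point runs along [l]: at time [s] the loop runs back
    from [l s] to [y], then along [a], then out to [l s] again. *)
Lemma conj_freely_homotopic x y (a : {path I from y to y in X})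
    (l : {path I from y to x in X}) :
  exists2 b : {path I from x to x in X},
    freely_homotopic a b & hpath b (path_inv l \* (a \* l)).
Proof.
(* At time [s] the parameter [u] sweeps [-s, 1 + s]; the loop [a] occupies
   [0, 1] and the two copies of [l] grow on either side of it. *)
pose u (v : I * I) : R := ival v.1 * (1 + 2 * ival v.2) - ival v.2.
have cu : continuous u.
  have c1 : continuous (fun v : I * I => ival v.1).
    by apply: continuous_cmp; [exact: ival_continuous | exact: continuous_fst].
  have c2 : continuous (fun v : I * I => ival v.2).
    by apply: continuous_cmp; [exact: ival_continuous | exact: continuous_snd].
  exact: (continuousRB (continuousRM c1 (continuousRD (@continuousRc _ _ _)
           (continuousRM (@continuousRc _ _ _) c2))) c2).
pose H v := if u v <= 0 then l (clamp (0 - u v))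
  else if u v <= 1 then a (clamp (u v)) else l (clamp (u v - 1)).
have cH : continuous H.
  apply: continuous_paste => //.
  - apply: continuous_cmp; first exact: cts_fun.
    exact: (clamp_comp_continuous (continuousRB (@continuousRc _ _ _) cu)).
  - apply: continuous_paste => //.
    + by apply: continuous_cmp; [exact: cts_fun | exact: clamp_comp_continuous].
    + apply: continuous_cmp; first exact: cts_fun.
      exact: (clamp_comp_continuous (continuousRB cu (@continuousRc _ _ _))).
    + by move=> v ->; rewrite subrr [LHS]path_one [RHS]path_zero.
  - by move=> v ->; rewrite ler01 subrr [LHS]path_zero [RHS]path_zero.
have Ha t : H (t, zero) = a t.
  rewrite /H /u /= ival0 mulr0 addr0 mulr1 subr0 ival_le1.
  case: leP => t0; last by rewrite clampK.
  have -> : t = zero by apply: ival_inj; apply/eqP; rewrite ival0 eq_le t0 ival_ge0.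
  by rewrite ival0 subrr [LHS]path_zero path_zero.
have Hl0 s : H (zero, s) = l s.
  rewrite /H /u /= ival0 mul0r add0r; have := ival_ge0 s => s0.
  by rewrite ifT ?opprK ?add0r ?clampK//; lra.
have Hl1 s : H (one, s) = l s.
  rewrite /H /u /= ival1 mul1r; have := ival_ge0 s => s0.
  rewrite ifF; last by apply/negbTE; rewrite -ltNge; lra.
  have -> : 1 + 2 * ival s - ival s = ival s + 1 by lra.
  case: leP => s1; last by rewrite addrK clampK.
  have -> : s = zero by apply: ival_inj; apply/eqP; rewrite ival0 eq_le s0 andbT; lra.
  by rewrite ival0 add0r [LHS]path_one path_zero.
have cb : continuous (fun t => H (t, one)).
  apply: continuous_cmp; first exact: cH.
  by apply: continuous_mkpair => t; [exact: cvg_id | exact: cst_continuous].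
have b0 : H (zero, one) = x by rewrite Hl0 path_one.
have b1 : H (one, one) = x by rewrite Hl1 path_one.
exists (mk_path cb b0 b1); last exact: (hpath_conj_track cH).
by exists H; split=> // s; rewrite Hl0 Hl1.
Qed.

End path_homotopy.

#[local] Hint Resolve hpath_refl : core.

(** * Segments of a curve parametrised by the real line *)

Section segments.
Variables (R : realType) (X : topologicalType).
Local Notation I := (unit_interval R).

Definition line (r s : R) (t : I) : R := r + (s - r) * ival t.

Lemma line_continuous r s : continuous (line r s).
Proof.
exact: (continuousRD (@continuousRc _ _ _)
  (continuousRM (@continuousRc _ _ _) (@ival_continuous _))).
Qed.

Lemma line0 r s : line r s zero = r.
Proof. by rewrite /line ival0 mulr0 addr0. Qed.

Lemma line1 r s : line r s one = s.
Proof. by rewrite /line ival1 mulr1 addrC subrK. Qed.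

Lemma line_cst r t : line r r t = r.
Proof. by rewrite /line subrr mul0r addr0. Qed.

Lemma line_ball (r s u : R) (e : R) t :
  `|r - s| < e -> `|r - u| < e -> `|r - line s u t| < e.
Proof.
rewrite /line; have := ival_ge0 t; have := ival_le1 t; set v := ival t => v1 v0.
rewrite !ltr_norml => /andP[h1 h2] /andP[h3 h4].
by apply/andP; case: (leP s u) => su; split; nra.
Qed.

Variable f : R -> X.
Hypothesis cf : continuous f.

Lemma homotopic_comp_real (p q : I -> R) : continuous p -> continuous q ->
  p zero = q zero -> p one = q one -> homotopic_rel (f \o p) (f \o q).
Proof.
move=> cp cq e0 e1.
exists (fun v => f ((1 - ival v.2) * p v.1 + ival v.2 * q v.1)); split.
- by apply: continuous_cmp; [exact: cf | exact: continuous_interp].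
- by move=> t /=; rewrite ival0 subr0 mul0r mul1r addr0.
- by move=> t /=; rewrite ival1 subrr mul0r mul1r add0r.
- by move=> s /=; rewrite -e0 -e1 -!mulrDl subrK !mul1r.
Qed.

Lemma seg_continuous r s : continuous (f \o line r s).
Proof. by apply: continuous_cmp; [exact: cf | exact: line_continuous]. Qed.

Lemma seg_zero r s x : f r = x -> (f \o line r s) zero = x.
Proof. by rewrite /= line0. Qed.

Lemma seg_one r s x : f s = x -> (f \o line r s) one = x.
Proof. by rewrite /= line1. Qed.

(** The end-points are typed up to equality, because the end-points of a path
    extended to the real line equal the original ones only propositionally. *)
Definition seg r s x y (fr : f r = x) (fs : f s = y) : {path I from x to y in X} :=
  mk_path (@seg_continuous r s) (seg_zero s fr) (seg_one r fs).

(** No order is assumed on [r], [s] and [u]: the paths [seg] may backtrack, and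
    any two paths in the line with the same end-points are homotopic. *)
Lemma seg_cat r s u x y z (fr : f r = x) (fs : f s = y) (fs' : f s = y) (fu : f u = z) :
  hpath (seg fr fs \* seg fs' fu) (seg fr fu).
Proof.
pose p : {path I from r to s in R} := mk_path (@line_continuous r s) (line0 r s) (line1 r s).
pose q : {path I from s to u in R} := mk_path (@line_continuous s u) (line0 s u) (line1 s u).
apply: (@homotopic_eql _ _ (f \o path_cat p q)).
  by move=> t; rewrite /= /mk_path /path_cat_fun /=; case: ifP.
apply: homotopic_comp_real.
- exact: cts_fun.
- exact: line_continuous.
- by rewrite path_zero line0.
- by rewrite path_one line1.
Qed.

Lemma seg_cst r x (fr fr' : f r = x) : hpath (seg fr fr') (path_cst R x).
Proof.
by apply: hpath_eq => t; rewrite /= /mk_path /= line_cst.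
Qed.

End segments.

Lemma real_clopen (R : realType) (Q : R -> Prop) (r s : R) :
  (forall u, \forall v \near u, Q u <-> Q v) -> Q r -> Q s.
Proof.
move=> loc Qr.
have oQ : open [set u | Q u].
  by rewrite openE => u /= Qu; apply: filterS (loc u) => v [+ _]; exact.
have cQ : closed [set u | Q u].
  rewrite -openC openE => u /= Qu; apply: filterS (loc u) => v [_ h] /h.
  exact: Qu.
have : connected [set: R] by apply/connected_intervalP.
move=> /(_ [set u | Q u]) QT; have {}QT : [set u | Q u] = setT.
  by apply: QT; [exists r | exists [set u | Q u]; rewrite ?setTI..].
by have : [set: R] s by []; rewrite -QT.
Qed.

(** * Transfer of small loops and the ladder argument *)

Section small_paths.
Variables (R : realType) (X : uniformType).
Local Notation I := (unit_interval R).
Implicit Types E F G : set (X * X).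

Lemma path_cat_all (P : X -> Prop) x y z (a : {path I from x to y in X})
    (b : {path I from y to z in X}) :
  (forall t, P (a t)) -> (forall t, P (b t)) -> forall t, P (path_cat a b t).
Proof. by move=> Pa Pb t; rewrite /= /mk_path /path_cat_fun; case: ifP. Qed.

Lemma small_sub (E : set (X * X)) x (f : I -> X) :
  range f `<=` xsection E x <-> forall t, E (x, f t).
Proof.
split=> [fE t|fE _ [t _ <-]]; last exact/xsectionP.
by apply/xsectionP/fE; exists t.
Qed.

(** Small loop transfer, with the free homotopy replaced by conjugation by a
    path. *)
Definition transferable F E := forall x y (a : {path I from y to y in X})
  (l : {path I from y to x in X}), (forall t, F (y, a t)) ->
  exists2 c : {path I from x to x in X},
    forall t, E (x, c t) & hpath c (path_inv l \* (a \* l)).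

Lemma transfer_conj : unif_small_loop_transfer R X -> forall E, sym_entourage E ->
  exists2 F, sym_entourage F & transferable F E.
Proof.
move=> uslt E /uslt[F sF slt]; exists F => // x y a l /small_sub Fa.
have [b ab bl] := conj_freely_homotopic a l.
have [c /small_sub Ec cb] := slt x y a b Fa ab.
by exists c => //; apply: homotopic_trans cb bl.
Qed.

(** The paths are extended to [R], where balls are convex and which is
    connected; [G] bounds the rungs from [f r] to [g r], and [F] bounds loops
    that chain three [G]-steps from their base point. *)
Section ladder.
Variables (E F G : set (X * X)) (f g : R -> X) (x0 y z : X).
Hypotheses (sF : sym_entourage F) (sG : sym_entourage G).
Hypothesis FE : F `<=` E.
Hypothesis G3F : forall u v w t, G (u, v) -> G (v, w) -> G (w, t) -> F (u, t).
Hypothesis tr : transferable F E.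
Hypotheses (cf : continuous f) (cg : continuous g).
Hypotheses (f0 : f 0 = x0) (g0 : g 0 = x0) (f1 : f 1 = y) (g1 : g 1 = z).
Hypothesis rung : forall r, exists p : {path I from f r to g r in X}, bounded_path G p.

Lemma G2F u v w : G (u, v) -> G (v, w) -> F (u, w).
Proof. by move=> uv vw; apply: (G3F uv vw); exact: sym_entourage_refl. Qed.

Lemma bounded_centre x x' (p : {path I from x to x' in X}) : bounded_path G p ->
  exists2 u, G (x, u) & forall t, G (u, p t).
Proof.
move=> [u /small_sub pu]; exists u => //; apply: sym_entourageE => //.
by rewrite -(path_zero (s := p)).
Qed.

(** [f^-1 g] up to time [r], closed up through the rung [p]. *)
Definition rung_loop r (p : {path I from f r to g r in X}) : {path I from y to y in X} :=
  path_inv (seg cf f0 f1) \* (seg cg g0 erefl \* (path_inv p \* seg cf erefl f1)).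

Definition small_rung r := exists2 p : {path I from f r to g r in X}, bounded_path G p &
  exists2 c : {path I from y to y in X}, forall t, E (y, c t) & hpath c (rung_loop p).

(** At time [0] the loop is a small loop at [x0] conjugated by all of [f]. *)
Lemma rung_start : small_rung 0.
Proof.
have [p bp] := rung 0; have [u fu up] := bounded_centre bp.
exists p => //.
pose a := seg cg g0 erefl \* (path_inv p \* seg cf (erefl (f 0)) f0).
have [t|c Ec cE] := tr (a := a) (seg cf f0 f1).
  apply: (path_cat_all (P := fun v => F (x0, v))) => {}t.
    by rewrite /= /mk_path /= line_cst g0; exact: sym_entourage_refl.
  apply: (path_cat_all (P := fun v => F (x0, v))) => {}t.
    by rewrite -{1}f0; apply: (G2F fu); exact: up.
  by rewrite /= /mk_path /= line_cst f0; exact: sym_entourage_refl.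
exists c => //; rewrite cE /rung_loop /a.
by rewrite !hcatA seg_cat.
Qed.

(** The loop at time [s] is the loop at time [r] times the conjugate of a small
    quadrilateral based at [f r]; its factor at [y] can be taken in [B(y,E)]
    by transfer, and [B(y,E)] absorbs the product. *)
Lemma rung_step r s :
  (forall t, G (f r, f (line r s t))) -> (forall t, G (g r, g (line r s t))) ->
  (forall t, G (f r, f (line s r t))) -> small_rung r -> small_rung s.
Proof.
move=> Gf Gg Gf' [p bp [c Ec cp]].
have [q bq] := rung s.
have [u fu up] := bounded_centre bp; have [v fv vq] := bounded_centre bq.
exists q => //.
pose a := p \* (seg cg (erefl (g r)) (erefl (g s)) \*
  (path_inv q \* seg cf (erefl (f s)) (erefl (f r)))).
have [t|d Ed dE] := tr (a := a) (seg cf (erefl (f r)) f1).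
  apply: (path_cat_all (P := fun v => F (f r, v))) => {}t; first exact: G2F fu _.
  apply: (path_cat_all (P := fun v => F (f r, v))) => {}t.
    by apply: (G3F fu _ (Gg t)); have := up one; rewrite path_one.
  apply: (path_cat_all (P := fun v => F (f r, v))) => {}t.
    have frs : G (f r, f s) by have := Gf one; rewrite line1.
    by apply: (G3F frs fv); exact: vq.
  have h : forall v w, G (v, w) -> F (v, w).
    by move=> v' w vw; apply: G2F vw _; exact: sym_entourage_refl.
  exact/h/Gf'.
exists (c \* d).
  by apply: (path_cat_all (P := fun v => E (y, v))).
rewrite cp dE /rung_loop /a !hcatA hcat_pV hcatVp.
rewrite (seg_cat cf _ _ (erefl (f r)) f1).
by rewrite -(hcatA (seg cg g0 (erefl (g r)))) seg_cat.
Qed.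

(** Within a ball around [r] on which [f] and [g] vary little, [rung_step]
    applies between [r] and [s] in both directions. *)
Lemma rung_local r : \forall s \near r, small_rung r <-> small_rung s.
Proof.
have [H sH HG] := sym_entourage_split sG.
have near_close (h : R -> X) : continuous h -> \forall s \near r, H (h r, h s).
  move=> ch; have : nbhs (h r) (xsection H (h r)) by case: sH => entH _; exact: nbhs_entourage.
  move=> /ch; apply: (@filterS _ (nbhs r) _ (h @^-1` xsection H (h r))).
  by move=> s /xsectionP.
have /nbhs_ballP[e e0 eH] : \forall s \near r, H (f r, f s) /\ H (g r, g s).
  by apply: filterI; exact: near_close.
have re : `|r - r| < e by rewrite subrr normr0.
have close s u t : `|r - s| < e -> `|r - u| < e ->
    G (f s, f (line s u t)) /\ G (g s, g (line s u t)).
  move=> rs ru; have [fs gs] := eH s rs.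
  have [fl gl] := eH _ (line_ball t rs ru).
  by split; [apply: (HG _ (f r)) | apply: (HG _ (g r))] => //; exact: sym_entourageE.
apply/nbhs_ballP; exists e => // s rs.
have back u v t : `|r - u| < e -> `|r - v| < e -> G (f u, f (line v u t)).
  move=> ru rv; have [fu _] := eH u ru; have [fl _] := eH _ (line_ball t rv ru).
  by apply: (HG _ (f r)) => //; exact: sym_entourageE.
have [fwd bwd] := (fun t => close s r t rs re, fun t => close r s t re rs).
split; apply: rung_step => t.
- by case: (bwd t).
- by case: (bwd t).
- exact: back.
- by case: (fwd t).
- by case: (fwd t).
- exact: back.
Qed.

(** The final rung turns the loop at time [1] back into [f^-1 g]; the bounded
    path is centred at [y], like the loop. *)
Lemma ladder_bound : exists2 p : {path I from y to z in X},
  bounded_path E p & hpath (path_inv (seg cf f0 f1) \* seg cg g0 g1) p.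
Proof.
have [p bp [c Ec cp]] := real_clopen 1 rung_local rung_start.
have [u fu up] := bounded_centre bp.
(* The constant segments at time [1] retype the ends [f 1] and [g 1] of [p] as
   [y] and [z]. *)
exists (c \* (seg cf f1 erefl \* (p \* seg cg erefl g1))).
  exists y; apply/small_sub/(path_cat_all (P := fun v => E (y, v))) => // t.
  have yF w : F (y, w) -> E (y, w) by exact: FE.
  apply/yF; move: t; apply: (path_cat_all (P := fun v => F (y, v))) => t.
    by rewrite /= /mk_path /= line_cst f1; exact: sym_entourage_refl.
  apply: (path_cat_all (P := fun v => F (y, v))) => {}t.
    by rewrite -{1}f1; apply: (G2F fu).
  rewrite /= /mk_path /= line_cst -{1}f1.
  by apply: (G2F fu); have := up one; rewrite path_one.
rewrite cp /rung_loop !hcatA.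
rewrite -(hcatA (seg cf _ f1)) seg_cat seg_cst hcat1p hcatVp.
by rewrite seg_cat.
Qed.

End ladder.

End small_paths.

Arguments transferable R {X} F E.

(** * The two uniform structures *)

Section path_spaces.
Variables (R : realType) (X : uniformType) (x0 : X).
Local Notation I := (unit_interval R).
Implicit Types E F G : set (X * X).

Lemma james_sub_bp (lpcX : unif_locally_path_connected R X) :
  unif_small_loop_transfer R X -> forall E, sym_entourage E ->
  exists2 F, sym_entourage F & @james_ent R X x0 F `<=` @bp_ent R X x0 E.
Proof.
move=> uslt E sE; have [F0 sF0 tr0] := transfer_conj uslt sE.
pose F := F0 `&` E; have sF : sym_entourage F by exact: sym_entourageI.
have FE : F `<=` E by move=> ? [].
have tr : transferable R F E by move=> x y a l Fa; apply: tr0 => t; case: (Fa t).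
have [K sK KF] := sym_entourage_split sF; have [G sG GK] := sym_entourage_split sK.
have G3F u v w t : G (u, v) -> G (v, w) -> G (w, t) -> F (u, t).
  move=> uv vw wt; apply: (KF _ w); first exact: GK uv vw.
  by apply: GK wt _; exact: sym_entourage_refl.
have [H sH Hpath] := lpcX G sG.
exists H => // -[c d] [y [z [a [b /= [-> -> ab]]]]].
exists y, z, a, b; split=> //.
(* Composing with [clamp] extends a path to the real line by constants. *)
have ext u v (k : {path I from u to v in X}) :
    [/\ continuous (k \o @clamp R), (k \o @clamp R) 0 = u & (k \o @clamp R) 1 = v].
  split; [|exact: path_zero|exact: path_one].
  by apply: continuous_cmp; [exact: cts_fun | exact: clamp_continuous].
have [ca a0 a1] := ext _ _ a; have [cb b0 b1] := ext _ _ b.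
have segE u v (k : {path I from u to v in X}) (ck : continuous (k \o @clamp R))
    (k0 : (k \o @clamp R) 0 = u) (k1 : (k \o @clamp R) 1 = v) : hpath k (seg ck k0 k1).
  by apply: hpath_eq => t; rewrite /= /mk_path /= /line add0r subr0 mul1r clampK.
have [|p Ep abp] := ladder_bound sF sG FE G3F tr ca cb a0 b0 a1 b1.
  by move=> r; apply: Hpath; exact: ab.
exists p => //; apply: homotopic_trans abp.
by apply: homotopic_cat; [apply: homotopic_inv|]; exact: segE.
Qed.

(** The paths [g l^-1 cst l] and [g l^-1 a l] are pointwise [F]-close, and their
    difference in the fundamental groupoid is [l^-1 a l]. *)
Lemma small_loop_of_james_sub_bp E F :
  path_connected R X -> sym_entourage F ->
  @james_ent R X x0 F `<=` @bp_ent R X x0 E ->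
  forall x y (a : {path I from y to y in X}) (l : {path I from y to x in X}),
  (forall t, F (y, a t)) ->
  exists2 c : {path I from x to x in X}, bounded_path E c &
    hpath c (path_inv l \* (a \* l)).
Proof.
move=> pc sF FE x y a l Fa.
have [g] := pc x0 x.
have : @bp_ent R X x0 E (path_class (g \* (path_inv l \* (path_cst R y \* l))),
                      path_class (g \* (path_inv l \* (a \* l)))).
  apply: FE; exists x, x; do 2!eexists; split=> //.
  apply: path_cat_rel => [t|]; first exact: sym_entourage_refl.
  apply: path_cat_rel => [t|]; first exact: sym_entourage_refl.
  by apply: path_cat_rel => t; [exact: Fa | exact: sym_entourage_refl].
case=> x1 [x2 [p [q /= [gp gq [c Ec pqc]]]]].
have e1 := path_class_eq_end gp; have e2 := path_class_eq_end gq; subst x1 x2.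
exists c => //.
have pE : hpath p (g \* (path_inv l \* (path_cst R y \* l))).
  by apply: homotopic_sym; exact/path_class_eq.
have qE : hpath q (g \* (path_inv l \* (a \* l))).
  by apply: homotopic_sym; exact/path_class_eq.
have <- : hpath (path_inv p \* q) c by [].
rewrite pE qE hcat1p hcatVl hcatp1; exact: hcatVp.
Qed.

End path_spaces.

(** A bounded loop provided by the Berestovskii-Plaut structure has some centre
    [u], whereas transfer asks for a ball centred at the base point; halving the
    entourage recentres it. *)
Theorem theorem5p10 (R : realType) (X : uniformType) (x0 : X)
    (pcX : path_connected R X) (lpcX : unif_locally_path_connected R X) :
  unif_continuous (id : path_space_J lpcX x0 -> path_space_BP R x0) <->
  unif_small_loop_transfer R X.
Proof.
split=> [uc E sE|uslt A [E sE EA]]; last first.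
  have [F sF FE] := james_sub_bp x0 lpcX uslt sE.
  by exists F => // -[c d] /FE/EA.
have [G sG GE] := sym_entourage_split sE.
have bpG : @bp_entourage R X x0 (@bp_ent R X x0 G) by exists G.
have [F sF FG] := uc _ bpG.
have {}FG : @james_ent R X x0 F `<=` @bp_ent R X x0 G by move=> [c d] /FG.
exists F => // x y a b /small_sub Fa /freely_homotopic_conj[l bl].
have [c [u /small_sub Gc] cl] :=
  small_loop_of_james_sub_bp pcX sF FG l Fa.
exists c; last by apply: homotopic_trans cl (homotopic_sym bl).
apply/small_sub => t; apply: (GE _ u) => //; apply: sym_entourageE => //.
by rewrite -(path_zero (s := c)).
Qed.
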